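(* Let $c\in F\smallsetminus\{0\}$ with $v(c)>0$, let $m_c=\begin{pmatrix}c&0\\0&-c\end{pmatrix}$, and let $\chi$ be a character of $T=Z_G(m_c)$. Let $x\in\kappa$ and let $r$ be an integer satisfying $\mathfrak{c}(\chi)\le r\le v(c)$. Then for every $f\in V_{m_c,\chi}^{K_\epsilon}$: if $r>0$, $$(T_xf)(u_{\varpi^{-r}})=q\,\chi(\varpi)\, f(u_{\varpi^{-(r+1)}})+\chi^{-1}(\varpi)\, f(u_{\varpi^{-(r-1)}}),$$ and, if $\mathfrak{c}(\chi)=0$, $$(T_xf)(u_{\varpi^{-0}})=(q-1)\,\chi(\varpi)\, f(u_{\varpi^{-1}})+\left(\chi(\varpi)+\chi^{-1}(\varpi)\right) f(u_{\varpi^{-0}}).$$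
   Context: $F$ is a non-Archimedean local field of characteristic different from $2$, $\mathcal{O}$ its ring of integers, $\varpi$ a generator of the maximal ideal, $v$ the valuation of $F$, $\kappa=\mathcal{O}/\varpi\mathcal{O}$, $q=|\kappa|$. For a ring $A$, $A_\epsilon:=A[\epsilon]/(\epsilon^2)$. Put $G=\mathrm{PGL}_2(F)$, $G_\epsilon=\mathrm{PGL}_2(F_\epsilon)$, $K_\epsilon=\mathrm{PGL}_2(\mathcal{O}_\epsilon)$, $\mathfrak{g}=\mathfrak{sl}_2(F)$. Elements of $\mathrm{PGL}_2$ are written as matrices in $\mathrm{GL}_2$; $u_x:=\begin{pmatrix}1&x\\0&1\end{pmatrix}$, $t_x:=\begin{pmatrix}x&0\\0&1\end{pmatrix}$ (so $u_{\varpi^{-0}}=u_1$). One has $G_\epsilon=(1+\epsilon\mathfrak{g})\rtimes G$. For $x\in\kappa$ with a lift $\tilde x\in\mathcal{O}$, let $g_x=\begin{pmatrix}\varpi+\epsilon\tilde x&0\\0&1\end{pmatrix}\in G_\epsilon$; the double coset $K_\epsilon g_xK_\epsilon$ does not depend on the lift. $T_x:=q^{-1}\,\mathrm{ch}_{K_\epsilon g_xK_\epsilon}$ in the Hecke algebra of $(G_\epsilon,K_\epsilon)$ (Haar measure with $\mathrm{vol}(K_\epsilon)=1$); on the $K_\epsilon$-invariants $V^{K_\epsilon}$ of a smooth representation $V$ of $G_\epsilon$ it acts by $T_xv=q^{-1}\sum_{gK_\epsilon\subset K_\epsilon g_xK_\epsilon}gv$. $T\subset G$ is the subgroup of diagonal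 matrices $\{t_x:x\in F^\times\}$. A character is a smooth homomorphism to $\mathbb{C}^\times$; $\chi(\varpi)$ means $\chi(t_\varpi)$ and $\chi^{-1}(\varpi)=\chi(\varpi)^{-1}$. The conductor $\mathfrak{c}(\chi)$ is the smallest $\ell\in\mathbb{Z}_{\ge0}$ for which $\chi$ is trivial on $T_{(\ell)}$, where $T_{(0)}=\{t_x:v(x)=0\}$ and $T_{(\ell)}=\{t_x: v(x-1)\ge\ell\}$ for $\ell\ge1$. Fix an additive character $\psi_0:F\to\mathrm{U}(1)$ with $\{x\in F:\psi_0|_{x\mathcal{O}}=1\}=\mathcal{O}$, and for $m\in\mathfrak{g}$ let $\psi_m(m')=\psi_0(\mathrm{tr}(mm'))$. $V_{m_c,\chi}$ is the space of smooth functions $f:G_\epsilon\to\mathbb{C}$ such that $f((1+\epsilon m')g)=\psi_{m_c}(m')f(g)$ for $m'\in\mathfrak{g}$, $g\in G$; $f(zg)=\chi(z)f(g)$ for $z\in T$, $g\in G$; and the support of $f|_G$ is compact modulo left translation by $T$. $G_\epsilon$ acts by right translation. *)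

(* Defs.v *)
From HB Require Import structures.
From mathcomp Require Import all_boot all_order all_algebra ring_quotient.
From mathcomp Require Import finmap.
From mathcomp Require Import all_classical all_reals all_analysis.
From mathcomp Require Import complex.

Set Implicit Arguments.
Unset Strict Implicit.
Unset Printing Implicit Defensive.

Import Order.TTheory GRing.Theory Num.Theory.
Local Open Scope classical_set_scope.
Local Open Scope quotient_scope.
Local Open Scope ring_scope.

(* No compatibility between the two structures is required: this is only the
   domain of the construction of the topology of PGL_2(A). *)
#[short(type="topComUnitRingType")]
HB.structure Definition TopComUnitRing :=
  {A of GRing.ComUnitRing A & Topological A}.

(* [fval] is the normalized valuation; its value at 0 is irrelevant. *)
HB.mixin Record Field_isDiscretelyValued F of GRing.Field F & Topological F := {
  fval : F -> int ;
  fvalM : forall x y : F, x != 0 -> y != 0 -> fval (x * y) = fval x + fval y ;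
  fvalD : forall x y : F, x != 0 -> y != 0 -> x + y != 0 ->
    Num.min (fval x) (fval y) <= fval (x + y) ;
  fval_surj : exists2 x : F, x != 0 & fval x = 1 ;
  nbhs_fvalE : forall (x : F) (U : set F), nbhs x U <->
    exists n : int, forall y, (y - x == 0) || (n <= fval (y - x)) -> U y
}.

#[short(type="dvFieldType")]
HB.structure Definition DVField :=
  {F of GRing.Field F & Topological F & Field_isDiscretelyValued F}.

(* v(x) >= n, with v(0) = +oo *)
Definition vge (F : dvFieldType) (n : int) (x : F) : bool :=
  (x == 0) || (n <= fval x).

Definition integers (F : dvFieldType) : {pred F} := [pred x | vge 0 x].

Section Integers.
Variable F : dvFieldType.

Lemma fval1 : fval (1 : F) = 0.
Proof.
apply: (addrI (fval (1 : F))).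
by rewrite addr0 -fvalM ?oner_neq0// mulr1.
Qed.

Lemma fvalN1 : fval (-1 : F) = 0.
Proof.
have N1 : -1 != 0 :> F by rewrite oppr_eq0 oner_neq0.
have := fvalM _ _ N1 N1; rewrite mulrNN mulr1 fval1 => /esym/eqP.
by rewrite -mulr2n mulrn_eq0 /= => /eqP.
Qed.

Lemma vgeM m n (x y : F) : vge m x -> vge n y -> vge (m + n) (x * y).
Proof.
rewrite /vge mulf_eq0; have [//|x0 /=] := eqVneq x 0.
by have [//|y0 /= mx ny] := eqVneq y 0; rewrite fvalM// lerD.
Qed.

Lemma vgeB n (x y : F) : vge n x -> vge n y -> vge n (x - y).
Proof.
rewrite /vge; have [->|x0 /=] := eqVneq x 0.
  rewrite sub0r oppr_eq0 -mulN1r; have [//|y0 /= _ ny] := eqVneq y 0.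
  by rewrite fvalM ?oppr_eq0 ?oner_neq0// fvalN1 add0r.
have [->|y0 /= nx ny] := eqVneq y 0; first by rewrite subr0 => ->; rewrite orbT.
have [//|xy0 /=] := eqVneq (x - y) 0.
have Ny0 : - y != 0 by rewrite oppr_eq0.
apply: le_trans (fvalD _ _ x0 Ny0 xy0); rewrite le_min nx /= -mulN1r fvalM//.
  by rewrite fvalN1 add0r.
by rewrite oppr_eq0 oner_neq0.
Qed.

Fact integer_subring_closed : subring_closed (@integers F).
Proof.
split=> [|x y|x y]; rewrite !inE.
- by rewrite /vge fval1 lexx orbT.
- exact: vgeB.
- by move=> x0 y0; rewrite -[0]addr0; exact: vgeM.
Qed.
HB.instance Definition _ :=
  GRing.isSubringClosed.Build F (@integers F) integer_subring_closed.

End Integers.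

Section RingOfIntegers.
Variable F : dvFieldType.

Record intRing := IntRing { intval : F ; _ : intval \in @integers F }.
HB.instance Definition _ := [isSub of intRing for intval].
HB.instance Definition _ := [Choice of intRing by <:].
HB.instance Definition _ := [SubChoice_isSubComNzRing of intRing by <:].

Definition maxIdeal : {pred intRing} := [pred x : intRing | vge 1 (val x)].

Fact maxIdeal_closed : idealr_closed maxIdeal.
Proof.
split=> [||a x y]; rewrite !inE.
- by rewrite /vge rmorph0 eqxx.
- by rewrite /vge rmorph1 oner_eq0 fval1.
- move=> x1 y1; rewrite -[y]opprK rmorphB (rmorphM _ a x); apply: vgeB.
    by rewrite -[1]add0r; apply: vgeM => //; exact: valP a.
  by rewrite rmorphN -[- _]sub0r; apply: vgeB => //; rewrite /vge eqxx.
Qed.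
HB.instance Definition _ := isIdealr.Build intRing maxIdeal maxIdeal_closed.

Definition residueField := {ideal_quot maxIdeal}.

End RingOfIntegers.

HB.mixin Record DVField_isLocal F of DVField F := {
  fval_complete : forall u : nat -> F,
    (forall n : int, exists N : nat, forall i j : nat,
       (N <= i)%N -> (N <= j)%N -> vge n (u i - u j)) ->
    exists l : F, u @ \oo --> l ;
  finite_residueField : finite_set [set: residueField F]
}.

#[short(type="nonarchLocalFieldType")]
HB.structure Definition NonarchLocalField := {F of DVField F & DVField_isLocal F}.

Definition residueCard (F : nonarchLocalFieldType) : nat :=
  #|` fset_set [set: residueField F] |.

Definition uniformizer (F : dvFieldType) (varpi : F) := varpi != 0 /\ fval varpi = 1.

(* A[e]/(e^2), with (a, b) standing for a + e b *)
Definition dualNum (A : Type) : Type := (A * A)%type.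

Section Dual.
Variable A : comUnitRingType.
HB.instance Definition _ := GRing.Zmodule.on (dualNum A).
Implicit Types x y z : dualNum A.

Definition dual_mul x y : dualNum A := (x.1 * y.1, x.1 * y.2 + x.2 * y.1).
Definition dual_one : dualNum A := (1, 0).
Definition dual_inv x : dualNum A :=
  if x.1 \is a GRing.unit then (x.1^-1, - x.2 / x.1 ^+ 2) else x.

Fact dual_mulA : associative dual_mul.
Proof.
move=> [a b] [c d] [e f]; rewrite /dual_mul /=; congr (_, _); first by rewrite mulrA.
by rewrite !mulrDr !mulrDl !mulrA addrA.
Qed.

Fact dual_mulC : commutative dual_mul.
Proof.
move=> [a b] [c d]; rewrite /dual_mul /=; congr (_, _); first exact: mulrC.
by rewrite addrC mulrC [a * d]mulrC.
Qed.

Fact dual_mul1 : left_id dual_one dual_mul.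
Proof. by move=> [a b]; rewrite /dual_mul /= !mul1r mul0r addr0. Qed.

Fact dual_mulDl : left_distributive dual_mul +%R.
Proof.
move=> [a b] [c d] [e f]; rewrite /dual_mul /=.
by congr (_, _); rewrite /= !mulrDl // addrACA.
Qed.

Fact dual_one_neq0 : dual_one != 0.
Proof. by apply/eqP => -[] /eqP; rewrite oner_eq0. Qed.

HB.instance Definition _ := GRing.Zmodule_isComNzRing.Build (dualNum A)
  dual_mulA dual_mulC dual_mul1 dual_mulDl dual_one_neq0.

Definition dual_unit : {pred dualNum A} := [pred x : dualNum A | x.1 \is a GRing.unit].

Fact dual_mulV : {in dual_unit, left_inverse 1 dual_inv *%R}.
Proof.
move=> [a b]; rewrite inE /dual_inv /= => ua; rewrite ua.
congr (_, _) => /=; first by rewrite mulVr.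
by rewrite expr2 invrM// mulrA mulrVK// mulNr [a^-1 * b]mulrC subrr.
Qed.

Fact dual_unitP x y : y * x = 1 -> dual_unit x.
Proof. by case=> yx _; apply/unitrPr; exists y.1; rewrite mulrC. Qed.

Fact dual_inv_out : {in [predC dual_unit], dual_inv =1 id}.
Proof. by move=> x; rewrite !inE /dual_inv => /negbTE->. Qed.

HB.instance Definition _ := GRing.ComNzRing_hasMulInverse.Build (dualNum A)
  dual_mulV dual_unitP dual_inv_out.

Definition dual_eps : dualNum A := (0, 1).
Definition dual_inj (a : A) : dualNum A := (a, 0).
End Dual.

HB.instance Definition _ (A : topComUnitRingType) := Topological.on (dualNum A).

(* PGL_2(A) is the quotient GL_2(A)/A^*; this is the group of A-points of the
   group scheme PGL_2 for A local (F, O, F_e and O_e are). *)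
Section PGL2.
Variable A : comUnitRingType.

Record GL2 := MkGL2 { mxGL2 : 'M[A]_2 ; _ : mxGL2 \in unitmx }.
HB.instance Definition _ := [isSub of GL2 for mxGL2].
HB.instance Definition _ := [Choice of GL2 by <:].
Implicit Types g h k : GL2.

Definition scalar_equiv g h : bool :=
  `[< exists2 a : A, a \is a GRing.unit & val g = a *: val h >].

Fact scalar_equiv_is_equiv : equiv_class_of scalar_equiv.
Proof.
split=> [g|g h|h g k].
- by apply/asboolP; exists 1; rewrite ?unitr1// scale1r.
- apply/asboolP/asboolP => -[a ua e]; exists a^-1; rewrite ?unitrV//.
    by rewrite e scalerA mulVr// scale1r.
  by rewrite e scalerA mulVr// scale1r.
- move=> /asboolP[a ua ea] /asboolP[b ub eb]; apply/asboolP; exists (a * b).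
    by rewrite unitrM ua.
  by rewrite ea eb scalerA.
Qed.
Canonical scalar_equiv_equiv := EquivRelPack scalar_equiv_is_equiv.
Canonical scalar_equiv_encModRel := defaultEncModRel scalar_equiv.

Definition PGL2 := {eq_quot scalar_equiv}.
HB.instance Definition _ := Choice.on PGL2.
HB.instance Definition _ := EqQuotient.on PGL2.

Lemma PGL2_eqP g h :
  (\pi_PGL2 g = \pi_PGL2 h) <->
  exists2 a : A, a \is a GRing.unit & val g = a *: val h.
Proof.
split=> [/eqmodP/asboolP//|H]; exact/eqmodP/asboolP.
Qed.

Lemma PGL2_valW g h : val g = val h -> \pi_PGL2 g = \pi_PGL2 h.
Proof. by move=> /val_inj->. Qed.

Fact GL2_one_subproof : (1%:M : 'M[A]_2) \in unitmx.
Proof. exact: unitmx1. Qed.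
Definition GL2_one := MkGL2 GL2_one_subproof.

Fact GL2_mul_subproof g h : val g *m val h \in unitmx.
Proof. by rewrite unitmx_mul (valP g) (valP h). Qed.
Definition GL2_mul g h := MkGL2 (GL2_mul_subproof g h).

Fact GL2_inv_subproof g : invmx (val g) \in unitmx.
Proof. by rewrite unitmx_inv (valP g). Qed.
Definition GL2_inv g := MkGL2 (GL2_inv_subproof g).

(* the class of M in PGL_2(A), for M invertible; 1 otherwise *)
Definition pgl (M : 'M[A]_2) : PGL2 := \pi_PGL2 (insubd GL2_one M : GL2).

Definition PGL2_one : PGL2 := \pi_PGL2 GL2_one.
Definition PGL2_mul (x y : PGL2) : PGL2 := \pi_PGL2 (GL2_mul (repr x) (repr y)).
Definition PGL2_inv (x : PGL2) : PGL2 := \pi_PGL2 (GL2_inv (repr x)).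

Lemma PGL2_mulE g h :
  PGL2_mul (\pi_PGL2 g) (\pi_PGL2 h) = \pi_PGL2 (GL2_mul g h).
Proof.
rewrite /PGL2_mul; case: (piP PGL2 g) => g' /PGL2_eqP[a ua ea].
case: (piP PGL2 h) => h' /PGL2_eqP[b ub eb]; apply/esym/PGL2_eqP.
exists (a * b); first by rewrite unitrM ua ub.
by rewrite /= ea eb -scalemxAl -scalemxAr scalerA.
Qed.

Lemma PGL2_invE g : PGL2_inv (\pi_PGL2 g) = \pi_PGL2 (GL2_inv g).
Proof.
rewrite /PGL2_inv; case: (piP PGL2 g) => g' /PGL2_eqP[a ua ea].
apply/PGL2_eqP; exists a => //=; rewrite ea invmxZ; last first.
  by rewrite -ea (valP g).
by rewrite scalerA divrr// scale1r.
Qed.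

Fact PGL2_mulA : associative PGL2_mul.
Proof.
move=> x y z; rewrite -[x]reprK -[y]reprK -[z]reprK.
move: (repr x) (repr y) (repr z) => g h k.
rewrite (PGL2_mulE h k) (PGL2_mulE g h) (PGL2_mulE g _) (PGL2_mulE _ k).
by apply: PGL2_valW; rewrite /= mulmxA.
Qed.

Fact PGL2_mul1 : left_id PGL2_one PGL2_mul.
Proof.
move=> x; rewrite -[x]reprK; move: (repr x) => g; rewrite PGL2_mulE.
by apply: PGL2_valW; rewrite /= mul1mx.
Qed.

Fact PGL2_mulr1 : right_id PGL2_one PGL2_mul.
Proof.
move=> x; rewrite -[x]reprK; move: (repr x) => g; rewrite PGL2_mulE.
by apply: PGL2_valW; rewrite /= mulmx1.
Qed.

Fact PGL2_mulV : left_inverse PGL2_one PGL2_inv PGL2_mul.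
Proof.
move=> x; rewrite -[x]reprK; move: (repr x) => g; rewrite PGL2_invE PGL2_mulE.
by apply: PGL2_valW; rewrite /= mulVmx// (valP g).
Qed.

Fact PGL2_mulrV : right_inverse PGL2_one PGL2_inv PGL2_mul.
Proof.
move=> x; rewrite -[x]reprK; move: (repr x) => g; rewrite PGL2_invE PGL2_mulE.
by apply: PGL2_valW; rewrite /= mulmxV// (valP g).
Qed.

HB.instance Definition _ := isGroup.Build PGL2
  PGL2_mulA PGL2_mul1 PGL2_mulr1 PGL2_mulV PGL2_mulrV.

Definition mx22 (a b c d : A) : 'M[A]_2 :=
  \matrix_(i < 2, j < 2) if i == 0 then (if j == 0 then a else b)
                         else (if j == 0 then c else d).

Definition upgl (x : A) : PGL2 := pgl (mx22 1 x 0 1).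
Definition tpgl (x : A) : PGL2 := pgl (mx22 x 0 0 1).

End PGL2.

(* GL_2(A) carries the topology induced by M_2(A) = A^4, which for A = F and
   A = F_e already makes inversion continuous; PGL_2(A) carries the quotient
   topology. *)
Section PGL2Topology.
Variable A : topComUnitRingType.
HB.instance Definition _ := Topological.copy (GL2 A)
  (initial_topology (@mxGL2 A)).

(* This is [quotient_topology (PGL2 A)], rebuilt over the choice structure that
   [PGL2 A] already has. *)
Definition PGL2_open (U : set (PGL2 A)) : Prop :=
  open ((fun g : GL2 A => \pi_(PGL2 A) g) @^-1` U).

Fact PGL2_openT : PGL2_open setT.
Proof. by rewrite /PGL2_open preimage_setT; exact: openT. Qed.

Fact PGL2_openI (U V : set (PGL2 A)) :
  PGL2_open U -> PGL2_open V -> PGL2_open (U `&` V).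
Proof. exact: openI. Qed.

Fact PGL2_open_bigcup (I : Type) (U : I -> set (PGL2 A)) :
  (forall i, PGL2_open (U i)) -> PGL2_open (\bigcup_i U i).
Proof. by move=> oU; apply: bigcup_open => i _; exact: oU. Qed.

HB.instance Definition _ := isOpenTopological.Build (PGL2 A)
  PGL2_openT PGL2_openI PGL2_open_bigcup.
End PGL2Topology.

Section Cosets.
Local Open Scope group_scope.
Variable G : groupType.

Definition doubleCoset (K : set G) (g : G) : set G :=
  [set k1 * g * k2 | k1 in K & k2 in K].

Definition leftCosets (K S : set G) : set (set G) :=
  [set [set g * k | k in K] | g in S].

End Cosets.

Section Hecke.
Variables (R : realType) (F : nonarchLocalFieldType).
Local Notation G := (PGL2 F).
Local Notation Geps := (PGL2 (dualNum F)).

Definition integerDual : {pred dualNum F} :=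
  [pred x : dualNum F | (x.1 \in @integers F) && (x.2 \in @integers F)].

Definition GL2Oeps : set 'M[dualNum F]_2 :=
  [set M | [/\ M \in unitmx, M \is a mxOver integerDual
             & invmx M \is a mxOver integerDual]].

(* the image of GL_2(O_e) in G_e, that is, PGL_2(O_e) *)
Definition Keps : set Geps := [set pgl M | M in GL2Oeps].

(* [val (repr x)] is a lift of x to O; the double coset of [hecke_elt] does
   not depend on it. *)
Definition hecke_elt (varpi : F) (x : residueField F) : Geps :=
  tpgl (dual_inj varpi + @dual_eps F * dual_inj (val (repr x : intRing F))).

(* q^-1 times the sum of the translates g f over the cosets g K_e contained in
   K_e g_x K_e. The operator is meant for K_e-invariant f, for which
   [f (h * xget 1 C)] does not depend on the element of C chosen by [xget].
   There are finitely many cosets, so that the finitely supported sum is the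
   genuine one. *)
Definition heckeT (varpi : F) (x : residueField F) (f : Geps -> R[i]) : Geps -> R[i] :=
  fun h => (residueCard F)%:R^-1 *
    \sum_(C \in leftCosets Keps (doubleCoset Keps (hecke_elt varpi x)))
      f (h * xget 1 C)%g.

Definition torus : set G := [set @tpgl F x | x in [set x | x != 0]].

Definition torusFilt (l : nat) : set G :=
  [set @tpgl F x | x in
    [set x | if l == 0%N then x != 0 /\ fval x = 0 else vge l%:Z (x - 1)]].

(* Only the restriction of [chi] to [torus] is relevant. *)
Record isTorusCharacter (chi : G -> R[i]) : Prop := {
  torus_char_neq0 : forall z, torus z -> chi z != 0 ;
  torus_charM : forall z w, torus z -> torus w -> chi (z * w)%g = chi z * chi w ;
  torus_char_smooth : forall z, torus z ->
    exists l : nat, forall w, torusFilt l w -> chi (z * w)%g = chi z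
}.

Definition trivialOn (chi : G -> R[i]) (l : nat) : Prop :=
  forall z, torusFilt l z -> chi z = 1.

(* The set below is nonempty when [chi] is a (smooth) character. *)
Definition conductor (chi : G -> R[i]) : nat :=
  xget 0%N [set l | trivialOn chi l /\ forall k, trivialOn chi k -> (l <= k)%N].

(* Continuity is automatic, as psi0 is trivial on O. *)
Record isUnramifiedAddChar (psi0 : F -> R[i]) : Prop := {
  addCharD : forall x y, psi0 (x + y) = psi0 x * psi0 y ;
  addChar_norm : forall x, `|psi0 x| = 1 ;
  addChar_conductor : forall x,
    (forall y, y \in @integers F -> psi0 (x * y) = 1) <-> x \in @integers F
}.

Definition m_ (c : F) : 'M[F]_2 := mx22 c 0 0 (- c).

Definition psi_ (psi0 : F -> R[i]) (m m' : 'M[F]_2) : R[i] := psi0 (\tr (m *m m')).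

Definition inclG (g : G) : Geps := pgl (map_mx (@dual_inj F) (val (repr g))).

Definition one_plus_eps (m : 'M[F]_2) : Geps :=
  pgl (1%:M + @dual_eps F *: map_mx (@dual_inj F) m).

Record isV (psi0 : F -> R[i]) (c : F) (chi : G -> R[i]) (f : Geps -> R[i]) : Prop := {
  V_smooth : forall g : Geps, \forall h \near g, f h = f g ;
  V_psi : forall (m' : 'M[F]_2) (g : G), \tr m' = 0 ->
    f (one_plus_eps m' * inclG g)%g = psi_ psi0 (m_ c) m' * f (inclG g) ;
  V_chi : forall z g : G, torus z -> f (inclG (z * g)%g) = chi z * f (inclG g) ;
  V_support : exists2 Omega : set G, compact Omega &
    forall g : G, f (inclG g) != 0 ->
      exists z w : G, [/\ torus z, Omega w & g = (z * w)%g]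
}.

Definition Keps_invariant (f : Geps -> R[i]) : Prop :=
  forall k g : Geps, Keps k -> f (g * k)%g = f g.

End Hecke.

(* Main.v *)
(* With [pi = varpi + e xt], the left cosets in [K g_x K] are represented by
   [(pi, y; 0, 1)], for the q^2 values [y = y0 + e y1], and [(1, 0; e z, pi)], for the
   q values of [z]. Writing [u_b * rep = (1 + e m') g] with [g] in GL_2(F), the value
   of [tr (m_c m')] is [c xt / varpi], resp. [2 c b z - c xt / varpi]; for
   [b = varpi^-r] with [r <= v(c)] and [0 < v(c)] it is integral, so [psi_0] disappears.
   Up to scalars and the torus, [g] is [u_((b + y0) / varpi)], resp.
   [u_(varpi^-(r-1))]. Finally
   [(varpi^-r + y0) / varpi = (1 + varpi^r y0) varpi^-(r+1)], and the factor
   [1 + varpi^r y0] is absorbed by conjugating with the torus element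
   [t_(1 + varpi^r y0)], on which [chi] is trivial as soon as it is a unit and
   [conductor chi <= r]. *)
Require Import Defs.
From HB Require Import structures.
From mathcomp Require Import all_boot all_order all_algebra ring_quotient ring.
From mathcomp Require Import finmap.
From mathcomp Require Import all_classical all_reals all_analysis.
From mathcomp Require Import complex.

Set Implicit Arguments.
Unset Strict Implicit.
Unset Printing Implicit Defensive.

Import Order.TTheory GRing.Theory Num.Theory.
Local Open Scope ring_scope.

(** * Two-by-two matrices by entries, and their classes in [PGL2] *)

Section TwoByTwo.
Variable A : comUnitRingType.
Implicit Types a b c d : A.

Lemma mx22E (M : 'M[A]_2) : M = mx22 (M 0 0) (M 0 1) (M 1 0) (M 1 1).
Proof.
apply/matrixP => i j; rewrite mxE.
by case: i => -[|[|//]] ?; case: j => -[|[|//]] ?; rewrite /=; congr (M _ _); apply: val_inj.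
Qed.

Lemma mx22_inj a b c d a' b' c' d' : mx22 a b c d = mx22 a' b' c' d' ->
  [/\ a = a', b = b', c = c' & d = d'].
Proof.
by move=> e; split; [move/matrixP: e => /(_ 0 0)|move/matrixP: e => /(_ 0 1)
  |move/matrixP: e => /(_ 1 0)|move/matrixP: e => /(_ 1 1)]; rewrite !mxE.
Qed.

Lemma mul_mx22 a b c d a' b' c' d' :
  mx22 a b c d *m mx22 a' b' c' d' =
  mx22 (a * a' + b * c') (a * b' + b * d') (c * a' + d * c') (c * b' + d * d').
Proof.
rewrite [LHS]mx22E !mxE !big_ord_recl !big_ord0 !mxE /= !addr0.
by congr mx22.
Qed.

Lemma scale_mx22 k a b c d :
  k *: mx22 a b c d = mx22 (k * a) (k * b) (k * c) (k * d).
Proof. by rewrite [LHS]mx22E !mxE. Qed.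

Lemma scalar_mx22 a : a%:M = mx22 a 0 0 a.
Proof. by rewrite [LHS]mx22E !mxE. Qed.

Lemma add_mx22 a b c d a' b' c' d' :
  mx22 a b c d + mx22 a' b' c' d' = mx22 (a + a') (b + b') (c + c') (d + d').
Proof. by rewrite [LHS]mx22E !mxE. Qed.

Lemma det_mx22 a b c d : \det (mx22 a b c d) = a * d - b * c.
Proof.
rewrite (expand_det_row _ 0) !big_ord_recl big_ord0 /cofactor !det_mx11 !mxE /=.
rewrite addr0 expr0 expr1 mul1r mulN1r; ring.
Qed.

Lemma trace_mx22 a b c d : \tr (mx22 a b c d) = a + d.
Proof. by rewrite /mxtrace !big_ord_recl big_ord0 !mxE /= addr0. Qed.

Lemma unitmx_mx22 a b c d :
  (mx22 a b c d \in unitmx) = (a * d - b * c \is a GRing.unit).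
Proof. by rewrite unitmxE det_mx22. Qed.

Lemma invmx_mx22 a b c d : mx22 a b c d \in unitmx ->
  invmx (mx22 a b c d) = (a * d - b * c)^-1 *: mx22 d (- b) (- c) a.
Proof.
move=> uM; rewrite -[RHS](mulKmx uM) -scalemxAr mul_mx22.
rewrite (_ : mx22 (a * d + _) _ _ _ = (a * d - b * c)%:M); last first.
  by rewrite scalar_mx22; congr mx22; ring.
by rewrite scale_scalar_mx mulVr -?unitmx_mx22 ?mulmx1.
Qed.

(** Invertibility of both factors keeps [pgl] away from its default value, the identity class. *)
Lemma pglM (M N : 'M[A]_2) : M \in unitmx -> N \in unitmx ->
  (pgl M * pgl N)%g = pgl (M *m N).
Proof.
move=> uM uN; rewrite [LHS]PGL2_mulE; apply: PGL2_valW => /=.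
by rewrite !insubdK ?unitmx_mul ?uM.
Qed.

Lemma pgl_eqP (M N : 'M[A]_2) : M \in unitmx -> N \in unitmx ->
  pgl M = pgl N <-> exists2 a, a \is a GRing.unit & M = a *: N.
Proof. by move=> uM uN; rewrite /pgl PGL2_eqP !insubdK. Qed.

Lemma pgl_scale (M : 'M[A]_2) a : M \in unitmx -> a \is a GRing.unit ->
  pgl (a *: M) = pgl M.
Proof.
by move=> uM ua; apply/pgl_eqP => //; [rewrite unitmxZ|exists a].
Qed.

Lemma pgl_repr (g : PGL2 A) : pgl (val (repr g)) = g.
Proof.
rewrite -[RHS]reprK; apply: PGL2_valW.
by rewrite insubdK// (valP (repr g)).
Qed.

Lemma pglV (M : 'M[A]_2) : M \in unitmx -> (pgl M)^-1%g = pgl (invmx M).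
Proof.
move=> uM; rewrite [LHS]PGL2_invE; apply: PGL2_valW => /=.
by rewrite !insubdK ?unitmx_inv.
Qed.

Lemma pgl1 : pgl 1%:M = 1%g :> PGL2 A.
Proof. by apply: PGL2_valW; rewrite insubdK ?unitmx1. Qed.

End TwoByTwo.

Lemma map_mx22 (A B : comUnitRingType) (h : A -> B) a b c d :
  map_mx h (mx22 a b c d) = mx22 (h a) (h b) (h c) (h d).
Proof. by rewrite [LHS]mx22E !mxE. Qed.

(** * Elementary properties of the valuation and powers of a uniformizer *)

Section Valuation.
Variable F : dvFieldType.
Implicit Types (x y : F) (m n : int).

Lemma vge0 n : vge n (0 : F).
Proof. by rewrite /vge eqxx. Qed.

Lemma vge1 : vge 0 (1 : F).
Proof. by rewrite /vge fval1 lexx orbT. Qed.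

Lemma vgeW m n x : m <= n -> vge n x -> vge m x.
Proof. by move=> mn /orP[/eqP->|nx]; rewrite ?vge0// /vge (le_trans mn nx) orbT. Qed.

Lemma vgeN n x : vge n (- x) = vge n x.
Proof.
have h y : vge n y -> vge n (- y) by move=> ?; rewrite -sub0r vgeB ?vge0.
by apply/idP/idP => /h; rewrite ?opprK.
Qed.

Lemma vgeD n x y : vge n x -> vge n y -> vge n (x + y).
Proof. by move=> nx ny; rewrite -[y]opprK; apply: vgeB; rewrite ?vgeN. Qed.

Lemma fvalV x : x != 0 -> fval x^-1 = - fval x.
Proof.
move=> x0; apply: (addrI (fval x)).
by rewrite -fvalM ?invr_eq0// mulfV// fval1 subrr.
Qed.

Lemma vgeV x : fval x = 0 -> vge 0 x^-1.
Proof.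
by have [->|x0 e] := eqVneq x 0; rewrite ?invr0 ?vge0// /vge fvalV// e lexx orbT.
Qed.

Lemma vge_gt0 x : x != 0 -> vge 0 x -> fval x != 0 -> vge 1 x.
Proof. by rewrite /vge => /negPf-> /= x0 x1; rewrite -gtz0_ge1 lt_def x1. Qed.

(** Otherwise [1 = (1 + x) - x] would lie in the maximal ideal. *)
Lemma fvalD1 x : vge 1 x -> 1 + x != 0 /\ fval (1 + x) = 0.
Proof.
move=> vx; have nv1 : ~~ vge 1 (1 : F) by rewrite /vge oner_eq0 fval1.
have nv : ~~ vge 1 (1 + x).
  by apply: contra nv1 => /vgeB /(_ vx); rewrite addrK.
have x0 : 1 + x != 0 by apply: contra nv => /eqP->; exact: vge0.
split=> //; apply/eqP; apply: contraNT nv => h; apply: vge_gt0 => //.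
by apply: vgeD; [rewrite /vge fval1 lexx orbT | exact: vgeW vx].
Qed.

Variables (varpi : F) (hvarpi : uniformizer varpi).

Lemma uniformizer_neq0 : varpi != 0. Proof. by case: hvarpi. Qed.

Lemma fval_expz n : fval (varpi ^ n) = n.
Proof.
have [p0 p1] := hvarpi.
have e k : fval (varpi ^+ k) = k%:Z.
  by elim: k => [|k IH]; rewrite ?fval1// exprS fvalM ?expf_neq0// p1 IH -intS.
case: n => k; first exact: e.
by rewrite NegzE -exprnN fvalV ?expf_neq0// e.
Qed.

Lemma vge_expz n : vge n (varpi ^ n).
Proof. by rewrite /vge fval_expz lexx orbT. Qed.

Lemma vge_divz m n x : vge n x -> vge (n - m) (x / varpi ^ m).
Proof. by move=> nx; rewrite invr_expz; apply: vgeM => //; exact: vge_expz. Qed.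

End Valuation.

(** * Lifts of residue classes to the ring of integers *)

Section ResidueLift.
Variables (F : nonarchLocalFieldType) (varpi : F) (hvarpi : uniformizer varpi).
Implicit Types x : F.

(** The section [repr] need not respect any ring operation: [rlift 0], for instance, is only known
    to lie in the maximal ideal. *)
Definition rlift (k : residueField F) : F := val (repr k : intRing F).

Lemma vge_rlift k : vge 0 (rlift k).
Proof. exact: (valP (repr k : intRing F)). Qed.

Lemma rlift_surj x : vge 0 x ->
  exists (k : residueField F) (e : F), vge 0 e /\ x = rlift k + varpi * e.
Proof.
move=> x0; pose a : intRing F := IntRing x0.
pose k : residueField F := \pi_(residueField F)%qT a.
exists k, ((x - rlift k) / varpi); split; last first.
  by rewrite mulrC divfK ?(uniformizer_neq0 hvarpi)// addrC subrK.
rewrite -[varpi]expr1z -(subrr (1 : int)); apply: (vge_divz hvarpi).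
have: a - repr k \in @maxIdeal F.
  by rewrite Quotient.idealrBE reprK.
by [].
Qed.

Lemma rlift_inj k k' (e : F) : vge 0 e -> rlift k - rlift k' = varpi * e -> k = k'.
Proof.
move=> e0 h; have: (repr k : intRing F) - repr k' \in @maxIdeal F.
  rewrite inE rmorphB /= -/(rlift k) -/(rlift k') h -[1]addr0.
  by apply: vgeM => //; rewrite -[varpi]expr1z (vge_expz hvarpi).
by rewrite Quotient.idealrBE !reprK => /eqP.
Qed.

End ResidueLift.

(** * Component formulas for dual numbers *)

Section DualNumbers.
Variable A : comUnitRingType.
Implicit Types x y : dualNum A.

(** A bare pair would be read in the product ring; the ascribed type selects the multiplication of
    dual numbers. *)
Definition dualpair (a b : A) : dualNum A := (a, b).

Lemma dualpair1 a b : (dualpair a b).1 = a. Proof. by []. Qed.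
Lemma dualpair2 a b : (dualpair a b).2 = b. Proof. by []. Qed.

Lemma dualP x y : x.1 = y.1 -> x.2 = y.2 -> x = y.
Proof. by case: x y => ? ? [? ?] /= -> ->. Qed.

Lemma dualM1 x y : (x * y).1 = x.1 * y.1. Proof. by []. Qed.
Lemma dualM2 x y : (x * y).2 = x.1 * y.2 + x.2 * y.1. Proof. by []. Qed.
Lemma dualD1 x y : (x + y).1 = x.1 + y.1. Proof. by []. Qed.
Lemma dualD2 x y : (x + y).2 = x.2 + y.2. Proof. by []. Qed.
Lemma dualN1 x : (- x).1 = - x.1. Proof. by []. Qed.
Lemma dualN2 x : (- x).2 = - x.2. Proof. by []. Qed.
Lemma dual01 : (0 : dualNum A).1 = 0. Proof. by []. Qed.
Lemma dual02 : (0 : dualNum A).2 = 0. Proof. by []. Qed.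
Lemma dual11 : (1 : dualNum A).1 = 1. Proof. by []. Qed.
Lemma dual12 : (1 : dualNum A).2 = 0. Proof. by []. Qed.
Definition dualE := (dualM1, dualM2, dualD1, dualD2, dualN1, dualN2,
  dual01, dual02, dual11, dual12, dualpair1, dualpair2).

Lemma dual_unitE x : (x \is a GRing.unit) = (x.1 \is a GRing.unit).
Proof. by []. Qed.

Lemma dualV1 x : x.1 \is a GRing.unit -> (x^-1).1 = x.1^-1.
Proof. by rewrite /GRing.inv /= /dual_inv => ->. Qed.

Lemma dualV2 x : x.1 \is a GRing.unit -> (x^-1).2 = - x.2 / x.1 ^+ 2.
Proof. by rewrite [in LHS]/GRing.inv /= /dual_inv => ->. Qed.

End DualNumbers.

Fact integerDual_subring_closed (F : nonarchLocalFieldType) :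
  subring_closed (@integerDual F).
Proof.
split=> [|x y|x y]; rewrite !inE.
- by rewrite vge0 /vge fval1 lexx orbT.
- by move=> /andP[? ?] /andP[? ?]; rewrite !dualE !vgeB.
- move=> /andP[x1 x2] /andP[y1 y2]; rewrite !dualE -[0]addr0 vgeM//=.
  by rewrite vgeD// vgeM.
Qed.
HB.instance Definition _ (F : nonarchLocalFieldType) :=
  GRing.isSubringClosed.Build (dualNum F) (@integerDual F)
    (integerDual_subring_closed F).

(** * Units, invertible matrices and division with remainder over O_e *)

Section IntegralDualNumbers.
Variable F : nonarchLocalFieldType.
Implicit Types x y a b c d : dualNum F.
Local Notation O_ := (@integerDual F).

(** The units of O_e. Nonvanishing of [x.1] is a separate condition because [fval] has no meaning at
    0. *)
Definition dunit : {pred dualNum F} :=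
  [pred x : dualNum F | [&& x.1 != 0, fval x.1 == 0 & vge 0 x.2]].

Lemma dunit_int x : x \in dunit -> x \in O_.
Proof. by rewrite !inE => /and3P[_ /eqP e ->]; rewrite /vge e lexx orbT. Qed.

Lemma dunit_unit x : x \in dunit -> x \is a GRing.unit.
Proof. by rewrite inE => /and3P[x0 _ _]; rewrite dual_unitE unitfE. Qed.

Lemma dunitN x : (- x \in dunit) = (x \in dunit).
Proof.
rewrite !inE !dualE oppr_eq0 vgeN; case: eqP => //= /eqP x0.
by rewrite -mulN1r fvalM ?oppr_eq0 ?oner_neq0// fvalN1 add0r.
Qed.

Lemma dunitV_int x : x \in dunit -> x^-1 \in O_.
Proof.
move=> ux; move: (ux); rewrite !inE => /and3P[x0 /eqP xe x2].
have u1 : x.1 \is a GRing.unit by rewrite unitfE.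
rewrite dualV1// dualV2// vgeV//= -[0]addr0 vgeM ?vgeN//.
by rewrite -exprVn expr2 -[0]addr0; apply: vgeM; exact: vgeV.
Qed.

Lemma dunitP x : x \is a GRing.unit -> x \in O_ -> x^-1 \in O_ -> x \in dunit.
Proof.
rewrite dual_unitE unitfE => ux /andP[x1]; rewrite inE => x2 /andP[y1 _].
rewrite inE ux x2 andbT /=; move: x1 y1; rewrite dualV1 ?unitfE//.
by rewrite !inE /vge invr_eq0 (negPf ux) /= fvalV// oppr_ge0 eq_le => -> ->.
Qed.

(** O_e is a local ring: were [b] and [d] both non-units, the first component of the determinant
    would lie in the maximal ideal. *)
Lemma dunit_local a b c d : a \in O_ -> b \in O_ -> c \in O_ -> d \in O_ ->
  a * d - b * c \in dunit -> ~~ (d \in dunit) ->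
  [/\ b \in dunit & vge 1 d.1].
Proof.
have nu x : x \in O_ -> x \notin dunit -> vge 1 x.1.
  rewrite !inE => /andP[x1 x2]; rewrite x2 andbT negb_and negbK.
  have [->|x0 /=] := eqVneq x.1 0; first by rewrite vge0.
  exact: vge_gt0.
move=> aO bO cO dO h /(nu _ dO) d1; split=> //; apply: contraLR h => /(nu _ bO) b1.
suff h : vge 1 (a * d - b * c).1.
  move: h; rewrite inE /vge; case: eqP => //= _ h; apply/nandP; left.
  by apply: contraTN h => /eqP->.
move: aO cO; rewrite !inE => /andP[a0 _] /andP[c0 _]; rewrite !dualE.
by apply: vgeB; [rewrite -[1]add0r|rewrite -[1]addr0]; apply: vgeM.
Qed.

(** Forward, the determinants of the matrix and of its inverse are integral and inverse to each
    other; backward, the adjugate formula gives an integral inverse. *)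
Lemma GL2OepsP a b c d : GL2Oeps (mx22 a b c d) <->
  [/\ a \in O_, b \in O_, c \in O_, d \in O_ & a * d - b * c \in dunit].
Proof.
have mxO (M : 'M[dualNum F]_2) : reflect
    [/\ M 0 0 \in O_, M 0 1 \in O_, M 1 0 \in O_ & M 1 1 \in O_]
    (M \is a mxOver O_).
  apply: (iffP mxOverP) => [h|[h1 h2 h3 h4] i j]; first by split.
  by rewrite [M]mx22E mxE; case: ifP => _; case: ifP => _.
split.
  case=> uM /mxO; rewrite !mxE /= => -[aO bO cO dO] /mxO VO; split=> //.
  apply: dunitP; rewrite -?unitmx_mx22// -?det_mx22 ?det_mx22 ?rpredB ?rpredM//.
  rewrite -det_mx22 -det_inv [invmx _]mx22E det_mx22.
  by case: VO => *; rewrite rpredB ?rpredM.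
case=> aO bO cO dO u; have uM : mx22 a b c d \in unitmx.
  by rewrite unitmx_mx22 dunit_unit.
split=> //; first by apply/mxO; rewrite !mxE.
by apply/mxO; rewrite invmx_mx22// !mxE /=; split; rewrite rpredM ?rpredN ?dunitV_int.
Qed.

Variables (varpi xt : F) (hvarpi : uniformizer varpi) (xt0 : vge 0 xt).
Local Notation varpi_eps := (dualpair varpi xt).

Lemma varpi_eps_unit : varpi_eps \is a GRing.unit.
Proof. by rewrite dual_unitE unitfE (uniformizer_neq0 hvarpi). Qed.

Lemma varpi_eps_int : varpi_eps \in O_.
Proof.
by rewrite !inE xt0 andbT -[varpi]expr1z; apply: vgeW (vge_expz hvarpi 1).
Qed.

(** Division with remainder by [varpi_eps], one component at a time: the quotient [e1] of the first
    components contributes [xt * e1] to the second one, which is subtracted before dividing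
    again. *)
Lemma dual_lift_surj y : y \in O_ ->
  exists k e, e \in O_ /\ y = dualpair (rlift k.1) (rlift k.2) + varpi_eps * e.
Proof.
rewrite inE => /andP[/(rlift_surj hvarpi)[k0 [e1 [e10 y1]]] y20].
have /(rlift_surj hvarpi)[k1 [e2 [e20 y2]]] : vge 0 (y.2 - xt * e1).
  by rewrite vgeB// -[0]addr0 vgeM.
exists (k0, k1), (dualpair e1 e2); rewrite !inE e10 e20; split=> //.
apply: dualP; rewrite !dualE //=.
by rewrite addrA -y2 subrK.
Qed.

(** A first component in the maximal ideal leaves remainder 0; the literal 0 appears because
    [rlift 0] may differ from it. *)
Lemma dual_lift_surj1 y : y \in O_ -> vge 1 y.1 ->
  exists k e, e \in O_ /\ y = dualpair 0 (rlift k) + varpi_eps * e.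
Proof.
rewrite inE => /andP[_ y20] /(vge_divz hvarpi 1); rewrite expr1z subrr => e10.
have /(rlift_surj hvarpi)[k1 [e2 [e20 y2]]] : vge 0 (y.2 - xt * (y.1 / varpi)).
  by rewrite vgeB// -[0]addr0 vgeM.
exists k1, (dualpair (y.1 / varpi) e2); rewrite !inE e10 e20; split=> //.
apply: dualP; rewrite !dualE //=.
  by rewrite add0r mulrC divfK// (uniformizer_neq0 hvarpi).
by rewrite addrA -y2 subrK.
Qed.

(** The first components identify [k.1] with [k'.1]; this forces [e.1 = 0], so that [xt * e.1] drops
    out of the second components. *)
Lemma dual_lift_inj k k' e : e \in O_ ->
  dualpair (rlift k.1) (rlift k.2) - dualpair (rlift k'.1) (rlift k'.2) = varpi_eps * e ->
  k = k'.
Proof.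
case: k k' => [k0 k1] [k0' k1']; rewrite inE => /andP[e1 e2] /= h.
have h1 : rlift k0 - rlift k0' = varpi * e.1 by move: (congr1 fst h).
have k0E := rlift_inj hvarpi e1 h1; subst k0'.
have h2 : rlift k1 - rlift k1' = varpi * e.2 + xt * e.1 by move: (congr1 snd h).
suff e10 : e.1 = 0.
  by move: h2; rewrite e10 mulr0 addr0 => /(rlift_inj hvarpi e2)->.
move/eqP: h1; rewrite subrr eq_sym mulf_eq0 (negPf (uniformizer_neq0 hvarpi)).
by move/eqP.
Qed.

End IntegralDualNumbers.

(** * The subgroup [Keps] and its left cosets *)

Section Cosets.
Variable F : nonarchLocalFieldType.
Implicit Types (a b c d : dualNum F) (g : PGL2 (dualNum F)).
Local Notation O_ := (@integerDual F).
Local Notation coset g := ([set (g * k)%g | k in @Keps F])%classic.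

Lemma Keps_mx22 a b c d : a \in O_ -> b \in O_ -> c \in O_ -> d \in O_ ->
  a * d - b * c \in @dunit F -> Keps (pgl (mx22 a b c d)).
Proof. by move=> *; exists (mx22 a b c d) => //; apply/GL2OepsP; split. Qed.

Lemma KepsP (k : PGL2 (dualNum F)) : Keps k -> exists a b c d,
  [/\ k = pgl (mx22 a b c d), a \in O_, b \in O_ & [/\ c \in O_, d \in O_ &
      a * d - b * c \in @dunit F]].
Proof.
case=> M MO <-; move: MO; rewrite [M]mx22E => /GL2OepsP[*].
by exists (M 0 0), (M 0 1), (M 1 0), (M 1 1).
Qed.

Lemma Keps1 : Keps (1%g : PGL2 (dualNum F)).
Proof.
by rewrite -pgl1 scalar_mx22; apply: Keps_mx22; rewrite ?rpred0 ?rpred1//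
  !(mulr0, mulr1) subr0 !inE !dualE oner_neq0 fval1 eqxx vge0.
Qed.

Lemma KepsM (k k' : PGL2 (dualNum F)) : Keps k -> Keps k' -> Keps (k * k')%g.
Proof.
move=> [M [uM MO VMO] <-] [N [uN NO VNO] <-]; rewrite pglM//.
exists (M *m N) => //; split; rewrite ?unitmx_mul ?uM ?mxOverM//.
by rewrite -[_ *m _]/(M * N) -[invmx _]/((M * N)^-1) invrM ?mxOverM.
Qed.

Lemma KepsV (k : PGL2 (dualNum F)) : Keps k -> Keps k^-1%g.
Proof.
by move=> [M [uM MO VMO] <-]; rewrite pglV//; exists (invmx M) => //;
  split; rewrite ?unitmx_inv ?invmxK.
Qed.

Lemma coset_eqP g g' : coset g = coset g' <-> exists2 k, Keps k & (g * k)%g = g'.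
Proof.
split=> [e|[k kK <-]].
  have : coset g' g' by exists 1%g; [exact: Keps1 | rewrite mulg1].
  by rewrite -e => -[k kK gk]; exists k.
apply/seteqP; split=> _ [l lK <-].
  by exists (k^-1 * l)%g; [exact/KepsM/lK/KepsV | rewrite mulgA mulgK].
by exists (k * l)%g; [exact: KepsM | rewrite mulgA].
Qed.

(** Removes the quotients, so that cosets can be told apart by comparing matrix entries up to the
    scalar [l]. *)
Lemma pgl_coset_eq (A B : 'M[dualNum F]_2) : A \in unitmx -> B \in unitmx ->
  coset (pgl A) = coset (pgl B) -> exists a b c d l,
  [/\ A *m mx22 a b c d = l *: B, a \in O_, b \in O_ &
    [/\ c \in O_, d \in O_ & a * d - b * c \in @dunit F]].
Proof.
move=> uA uB /coset_eqP[_ /KepsP[a [b [c [d [-> aO bO [cO dO u]]]]]]].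
have uM : mx22 a b c d \in unitmx by rewrite unitmx_mx22 dunit_unit.
rewrite pglM// => e; have uAM : A *m mx22 a b c d \in unitmx.
  by rewrite unitmx_mul uA.
have [l _ {}e] := proj1 (pgl_eqP uAM uB) e.
by exists a, b, c, d, l.
Qed.

(** The inverse of [a] is [a * (a * a)^-1], which is integral. *)
Lemma dunit_sqrt a : a \in O_ -> a * a \in @dunit F -> a \in @dunit F.
Proof.
move=> aO u; have ua : a \is a GRing.unit.
  by have := dunit_unit u; rewrite unitrM => /andP[].
apply: dunitP => //; rewrite (_ : a^-1 = a * (a * a)^-1).
  by rewrite rpredM ?dunitV_int.
by rewrite invrM// mulrA divrr// mul1r.
Qed.

(** * Decomposition of the double coset of g_x into left cosets *)

Variables (varpi xt : F) (hvarpi : uniformizer varpi) (xt0 : vge 0 xt).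
Local Notation varpi_eps := (dualpair varpi xt).

Let uP := varpi_eps_unit xt hvarpi.
Let OP := varpi_eps_int hvarpi xt0.

(* Representatives of the left cosets in [K g_x K]: the points of the projective
   line over O_e/(varpi + e xt), which has residue field kappa and q^2 elements.
   The maximal ideal of that quotient is represented by the [e z], whatever [xt]. *)
Definition rep1 (k : residueField F * residueField F) : 'M[dualNum F]_2 :=
  mx22 varpi_eps (dualpair (rlift k.1) (rlift k.2)) 0 1.

Definition rep2 (k : residueField F) : 'M[dualNum F]_2 :=
  mx22 1 0 (dualpair 0 (rlift k)) varpi_eps.

Lemma rlift_pair_int k k' : dualpair (rlift k) (rlift k') \in O_.
Proof. by rewrite !inE !vge_rlift. Qed.

Lemma eps_rlift_int k : dualpair 0 (rlift k) \in O_.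
Proof. by rewrite !inE vge_rlift vge0. Qed.

Lemma rep1_unit k : rep1 k \in unitmx.
Proof. by rewrite unitmx_mx22 mulr0 subr0 mulr1. Qed.

Lemma rep2_unit k : rep2 k \in unitmx.
Proof. by rewrite unitmx_mx22 mul0r subr0 mul1r. Qed.

(** The bottom row gives [c = 0] and [d = l], the top left entry [a = d]. The determinant is then
    [d * d], so [d] is a unit, and the two lifts differ by [varpi_eps * (b / d)]. *)
Lemma rep1_inj k k' : coset (pgl (rep1 k)) = coset (pgl (rep1 k')) -> k = k'.
Proof.
case/(pgl_coset_eq (rep1_unit k) (rep1_unit k')) => a [b [c [d [l]]]].
rewrite mul_mx22 scale_mx22 => -[/mx22_inj[]].
rewrite !(mulr0, mul0r, mulr1, mul1r, add0r) => e1 e2 c0 dl aO bO [cO dO].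
subst c l; move: e1; rewrite mulr0 addr0 [d * _]mulrC => /(mulrI uP) ad.
rewrite ad mulr0 subr0 => /(dunit_sqrt dO) ud.
apply/esym/(dual_lift_inj (xt := xt) hvarpi (e := b / d)).
  by rewrite rpredM ?dunitV_int.
apply: (mulrI (dunit_unit ud)); rewrite mulrBr -e2 [d * _]mulrC addrK.
by rewrite [RHS]mulrCA [d * _]mulrC divrK ?dunit_unit.
Qed.

Lemma rep2_inj k k' : coset (pgl (rep2 k)) = coset (pgl (rep2 k')) -> k = k'.
Proof.
case/(pgl_coset_eq (rep2_unit k) (rep2_unit k')) => a [b [c [d [l]]]].
rewrite mul_mx22 scale_mx22 => -[/mx22_inj[]].
rewrite !(mulr0, mul0r, mulr1, mul1r, addr0) => al b0 e1 e2 aO bO [cO dO].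
subst b l; move: e2; rewrite mulr0 add0r [a * dualpair _ _]mulrC => /(mulrI uP) da.
rewrite da mul0r subr0 => /(dunit_sqrt aO) ua.
(* [dual_lift_inj] compares pairs of lifts, so both classes are given first component 0; the two
   copies of [rlift 0] cancel below. *)
suff [] : (0 : residueField F, k') = (0, k) by [].
apply: (dual_lift_inj (xt := xt) hvarpi (e := c / a)).
  by rewrite rpredM ?dunitV_int.
have -> : dualpair (rlift 0) (rlift k') - dualpair (rlift 0) (rlift k) =
          dualpair 0 (rlift k') - dualpair 0 (rlift k).
  by apply: dualP; rewrite !dualE /= ?subrr.
apply: (mulrI (dunit_unit ua)); rewrite mulrBr -e1 [a * _]mulrC addrAC subrr add0r.
by rewrite mulrCA [a * _]mulrC divrK ?dunit_unit.
Qed.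

(** Comparing entries, the first component of the determinant is [a.1 * (varpi * a.1 * varpi)],
    which lies in the maximal ideal. *)
Lemma rep12_neq k k' : coset (pgl (rep1 k)) <> coset (pgl (rep2 k')).
Proof.
case/(pgl_coset_eq (rep1_unit k) (rep2_unit k')) => a [b [c [d [l]]]].
rewrite mul_mx22 scale_mx22 => -[/mx22_inj[]].
rewrite !(mulr0, mul0r, mulr1, mul1r, add0r) => e1 _ c0 dl aO bO [cO dO].
subst c d; have := congr1 fst e1; rewrite !dualE /= !(mulr0, addr0) => l1.
rewrite inE !dualE /= -l1 !(mulr0, subr0) => /and3P[n0 /eqP v0 _].
suff : vge 1 (a.1 * (varpi * a.1 * varpi)) by rewrite /vge (negPf n0) v0.
have v1 : vge 1 varpi by rewrite -[varpi]expr1z; exact: vge_expz.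
have a0 : vge 0 a.1 by move: aO; rewrite !inE => /andP[].
rewrite -[1]add0r; apply: vgeM => //; rewrite -[1]add0r; apply: vgeM => //.
by rewrite -[0]addr0; apply: vgeM => //; exact: vgeW v1.
Qed.

Local Notation gx := (tpgl varpi_eps).

Lemma tpgl_varpi_eps_unit : mx22 varpi_eps 0 0 1 \in unitmx.
Proof. by rewrite unitmx_mx22 mul0r subr0 mulr1. Qed.

Lemma dunit1 : 1 \in @dunit F.
Proof. by rewrite !inE !dualE oner_neq0 fval1 eqxx vge0. Qed.

Lemma swap_Keps : Keps (pgl (mx22 0 1 1 0 : 'M[dualNum F]_2)).
Proof.
by apply: Keps_mx22; rewrite ?rpred0 ?rpred1// mul0r mul1r sub0r dunitN dunit1.
Qed.

Lemma rep1_doubleCoset k : doubleCoset (@Keps F) gx (pgl (rep1 k)).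
Proof.
exists (pgl (mx22 1 (dualpair (rlift k.1) (rlift k.2)) 0 1)).
  by apply: Keps_mx22; rewrite ?rpred0 ?rpred1 ?rlift_pair_int// mulr0 subr0 mulr1 dunit1.
exists 1%g; first exact: Keps1.
rewrite mulg1 /tpgl pglM; first last.
- exact: tpgl_varpi_eps_unit.
- by rewrite unitmx_mx22 mulr0 subr0 mulr1 unitr1.
by rewrite mul_mx22; congr (pgl (mx22 _ _ _ _)); ring.
Qed.

(** With [z = dualpair 0 (rlift k)], the product of [mx22 0 1 1 z], [mx22 varpi_eps 0 0 1] and
    [mx22 0 1 1 0] is [rep2 k]. *)
Lemma rep2_doubleCoset k : doubleCoset (@Keps F) gx (pgl (rep2 k)).
Proof.
have u1 : 0 * (dualpair 0 (rlift k)) - 1 * 1 \in @dunit F by rewrite mul0r mul1r sub0r dunitN dunit1.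
exists (pgl (mx22 0 1 1 (dualpair 0 (rlift k)))).
  by apply: Keps_mx22; rewrite ?rpred0 ?rpred1 ?eps_rlift_int.
exists (pgl (mx22 0 1 1 0)); first exact: swap_Keps.
have u2 : mx22 0 1 1 (dualpair 0 (rlift k)) \in unitmx.
  by rewrite unitmx_mx22 (dunit_unit u1).
have u3 : (mx22 0 1 1 0 : 'M[dualNum F]_2) \in unitmx.
  by rewrite unitmx_mx22 mul0r mul1r sub0r unitrN1.
have uu := tpgl_varpi_eps_unit.
rewrite /tpgl (pglM u2 uu).
have u4 : mx22 0 1 1 (dualpair 0 (rlift k)) *m mx22 varpi_eps 0 0 1 \in unitmx.
  by rewrite unitmx_mul u2.
by rewrite (pglM u4 u3) !mul_mx22; congr (pgl (mx22 _ _ _ _)); ring.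
Qed.

(** Only the factor to the left of [gx] affects the coset. Its second column is a point of the
    projective line: if [d] is a unit, [b / d] is reduced modulo [varpi_eps]; otherwise [b] is a
    unit and [d / b] is reduced. *)
Lemma doubleCoset_rep g : doubleCoset (@Keps F) gx g ->
  (exists k, coset g = coset (pgl (rep1 k))) \/
  (exists k, coset g = coset (pgl (rep2 k))).
Proof.
case=> _ /KepsP[a [b [c [d [-> aO bO [cO dO u]]]]]] [k2 k2K <-].
have uM : mx22 a b c d \in unitmx by rewrite unitmx_mx22 dunit_unit.
rewrite -(proj2 (coset_eqP (pgl (mx22 a b c d) * gx)%g _) (ex_intro2 _ _ k2 k2K erefl)).
suff H g' : g' = pgl (mx22 (a * varpi_eps) b (c * varpi_eps) d) ->
    (exists k, coset g' = coset (pgl (rep1 k))) \/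
    (exists k, coset g' = coset (pgl (rep2 k))).
  apply: H; rewrite /tpgl (pglM uM tpgl_varpi_eps_unit) mul_mx22.
  by congr (pgl (mx22 _ _ _ _)); ring.
move=> ->.
have [ud|nd] := boolP (d \in @dunit F).
  have bdO : b / d \in O_ by rewrite rpredM ?dunitV_int.
  have [k [e [eO be]]] := dual_lift_surj hvarpi xt0 bdO.
  left; exists k; apply/esym/coset_eqP.
  set y : dualNum F := (dualpair (rlift k.1) (rlift k.2)).
  have yO : y \in O_ by exact: rlift_pair_int.
  have bE : b = (y + varpi_eps * e) * d by rewrite -be divrK ?dunit_unit.
  have dE : (a - y * c) * d - d * e * (c * varpi_eps) = a * d - b * c.
    by rewrite bE; ring.
  (* This is the inverse of [rep1 k] times [mx22 (a * varpi_eps) b (c * varpi_eps) d]; the entry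
     [d * e] is [(b - y * d) / varpi_eps]. *)
  exists (pgl (mx22 (a - y * c) (d * e) (c * varpi_eps) d)).
    by apply: Keps_mx22; rewrite ?dE ?rpredB ?rpredM.
  have uN : mx22 (a - y * c) (d * e) (c * varpi_eps) d \in unitmx.
    by rewrite unitmx_mx22 dE (dunit_unit u).
  rewrite (pglM (rep1_unit k) uN).
  rewrite /rep1 mul_mx22.
  by rewrite bE -/y; congr (pgl (mx22 _ _ _ _)); ring.
have [ub d1] := dunit_local aO bO cO dO u nd.
have dbO : d / b \in O_ by rewrite rpredM ?dunitV_int.
have db1 : vge 1 (d / b).1.
  rewrite dualE -[1]addr0; apply: vgeM => //.
  by move: (dunitV_int ub); rewrite !inE => /andP[].
have [k [e [eO be]]] := dual_lift_surj1 hvarpi xt0 dbO db1.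
right; exists k; apply/esym/coset_eqP.
set z : dualNum F := dualpair 0 (rlift k).
have zO : z \in O_ by exact: eps_rlift_int.
have dE' : d = (z + varpi_eps * e) * b by rewrite -be divrK ?dunit_unit.
have dE : a * varpi_eps * (b * e) - b * (c - z * a) = a * d - b * c.
  by rewrite dE'; ring.
(* The same quotient with [rep2 k]; here [b * e] is [(d - z * b) / varpi_eps]. *)
exists (pgl (mx22 (a * varpi_eps) b (c - z * a) (b * e))).
  by apply: Keps_mx22; rewrite ?dE ?rpredB ?rpredM.
have uN : mx22 (a * varpi_eps) b (c - z * a) (b * e) \in unitmx.
  by rewrite unitmx_mx22 dE (dunit_unit u).
rewrite (pglM (rep2_unit k) uN).
rewrite /rep2 mul_mx22.
by rewrite dE' -/z; congr (pgl (mx22 _ _ _ _)); ring.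
Qed.

Lemma leftCosets_doubleCosetE : leftCosets (@Keps F) (doubleCoset (@Keps F) gx) =
  ([set coset (pgl (rep1 k)) | k in setT] `|`
   [set coset (pgl (rep2 k)) | k in setT])%classic.
Proof.
apply/seteqP; split=> [C [g /doubleCoset_rep[[k e]|[k e]] <-]|C [[k _ <-]|[k _ <-]]].
- by left; exists k.
- by right; exists k.
- by exists (pgl (rep1 k)) => //; exact: rep1_doubleCoset.
- by exists (pgl (rep2 k)) => //; exact: rep2_doubleCoset.
Qed.

Lemma fsum_leftCosets (V : nmodType) (h : set (PGL2 (dualNum F)) -> V) :
  \sum_(C \in leftCosets (@Keps F) (doubleCoset (@Keps F) gx)) h C =
  \sum_(k \in setT) h (coset (pgl (rep1 k))) +
  \sum_(k \in setT) h (coset (pgl (rep2 k))).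
Proof.
have fin := @finite_residueField F.
have fin2 : finite_set [set: residueField F * residueField F].
  by rewrite -setXTT; exact: finite_setX.
have i1 : set_inj setT (fun k => coset (pgl (rep1 k))).
  by move=> k k' _ _; exact: rep1_inj.
have i2 : set_inj setT (fun k => coset (pgl (rep2 k))).
  by move=> k k' _ _; exact: rep2_inj.
rewrite leftCosets_doubleCosetE fsbigU0.
- by rewrite (fsbig_image _ _ _ i1) (fsbig_image _ _ _ i2).
- exact: finite_image.
- exact: finite_image.
by move=> C [[k _ <-] [k' _ /esym]]; exact: rep12_neq.
Qed.

End Cosets.

Lemma fsum_const (R : pzRingType) (I : choiceType) (A : set I) (v : R) :
  finite_set A -> \sum_(i \in A) v = (#|` fset_set A|)%:R * v.
Proof.
by move=> fA; rewrite fsbig_finite//= big_const_seq count_predT iter_addr_0 mulr_natl.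
Qed.

(** * The embedding of [PGL2 F] in G_e, and the torus *)

Section Inclusion.
Variable F : nonarchLocalFieldType.
Implicit Types a b c d : F.

Lemma dual_injM a b : dual_inj (a * b) = dual_inj a * dual_inj b.
Proof. by apply: dualP; rewrite !dualE //= mulr0 mul0r addr0. Qed.

Lemma dual_inj_unitmx (M : 'M[F]_2) : M \in unitmx ->
  map_mx (@dual_inj F) M \in unitmx.
Proof.
rewrite [M]mx22E unitmx_mx22 => u.
by rewrite map_mx22 unitmx_mx22 dual_unitE.
Qed.

(** [inclG] goes through an arbitrary representative; any other differs by a scalar of F, which
    stays a unit scalar among the dual numbers. *)
Lemma inclG_pgl (M : 'M[F]_2) : M \in unitmx ->
  inclG (pgl M) = pgl (map_mx (@dual_inj F) M).
Proof.
move=> uM; rewrite /inclG.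
set N : 'M[F]_2 := val (repr (pgl M)).
have uN : N \in unitmx := valP (repr (pgl M)).
have [a ua NE] : exists2 a, a \is a GRing.unit & N = a *: M.
  by apply/(pgl_eqP uN uM); exact: pgl_repr.
apply/(pgl_eqP (dual_inj_unitmx uN) (dual_inj_unitmx uM)).
exists (dual_inj a); first by rewrite dual_unitE.
by rewrite NE; apply/matrixP => i j; rewrite !mxE dual_injM.
Qed.

Lemma upgl_unitmx b : mx22 1 b 0 1 \in unitmx.
Proof. by rewrite unitmx_mx22 mulr0 subr0 mulr1 unitr1. Qed.

Lemma tpgl_unitmx a : a != 0 -> mx22 a 0 0 1 \in unitmx.
Proof. by move=> a0; rewrite unitmx_mx22 mulr0 subr0 mulr1 unitfE. Qed.

Lemma inclGM (M N : 'M[F]_2) : M \in unitmx -> N \in unitmx ->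
  inclG (pgl M * pgl N)%g = (inclG (pgl M) * inclG (pgl N))%g.
Proof.
move=> uM uN; rewrite (pglM uM uN) inclG_pgl ?unitmx_mul ?uM// !inclG_pgl//.
rewrite (pglM (dual_inj_unitmx uM) (dual_inj_unitmx uN)); congr pgl.
rewrite [M]mx22E [N]mx22E mul_mx22 !map_mx22 mul_mx22.
by congr mx22; apply: dualP; rewrite !dualE /= ?(mulr0, mul0r, addr0).
Qed.

Lemma inclG_Keps a b c d : vge 0 a -> vge 0 b -> vge 0 c -> vge 0 d ->
  a * d - b * c != 0 -> fval (a * d - b * c) = 0 -> Keps (inclG (pgl (mx22 a b c d))).
Proof.
move=> a0 b0 c0 d0 n0 v0; rewrite inclG_pgl ?unitmx_mx22 ?unitfE// map_mx22.
by apply: Keps_mx22; rewrite !inE ?vge0 ?andbT// !dualE /= n0 v0 !(mulr0, mul0r, addr0)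
  subr0 vge0 eqxx.
Qed.

Lemma torus_tpgl a : a != 0 -> torus (tpgl a : PGL2 F).
Proof. by move=> a0; exists a. Qed.

Lemma tpglM a b : a != 0 -> b != 0 -> (tpgl a * tpgl b)%g = tpgl (a * b) :> PGL2 F.
Proof.
move=> a0 b0; rewrite /tpgl (pglM (tpgl_unitmx a0) (tpgl_unitmx b0)) mul_mx22.
by rewrite !(mulr0, mul0r, mulr1, addr0, add0r).
Qed.

End Inclusion.

(** * Characters of the torus and their conductor *)

Section TorusCharacter.
Variables (R : realType) (F : nonarchLocalFieldType).
Variables (chi : PGL2 F -> R[i]) (hchi : isTorusCharacter chi).

Lemma torus_char1 : chi (tpgl 1) = 1.
Proof.
have t1 : torus (tpgl 1 : PGL2 F) by apply: torus_tpgl; exact: oner_neq0.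
apply: (mulfI (torus_char_neq0 hchi t1)).
by rewrite -torus_charM// tpglM ?oner_neq0// mulr1 mulr1.
Qed.

Lemma torus_charV a : a != 0 -> chi (tpgl a^-1) = (chi (tpgl a))^-1.
Proof.
move=> a0; have ta := torus_tpgl a0; have va0 : a^-1 != 0 by rewrite invr_eq0.
apply: (mulfI (torus_char_neq0 hchi ta)).
rewrite mulfV ?(torus_char_neq0 hchi ta)// -torus_charM//; last exact: torus_tpgl.
by rewrite tpglM// mulfV// torus_char1.
Qed.

(** [conductor] is chosen by [xget] with default 0, so some level of triviality must be exhibited
    first; smoothness at the identity provides one. *)
Lemma conductor_trivialOn : trivialOn chi (conductor chi).
Proof.
have t1 : torus (tpgl 1 : PGL2 F) by apply: torus_tpgl; exact: oner_neq0.
have [l hl] := torus_char_smooth hchi t1.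
have ex : exists l, `[< trivialOn chi l >].
  (* At level [l.+1] the parameter [a] is congruent to 1 modulo the maximal ideal, hence a unit, and
     it lies in [torusFilt l] whether or not [l] is 0. *)
  exists l.+1; apply/asboolP => z [a /= al <-].
  have a1 : vge 1 (a - 1) by apply: vgeW al.
  have [a0 va] : a != 0 /\ fval a = 0.
    by have := fvalD1 a1; rewrite addrC subrK.
  have : torusFilt l (tpgl a : PGL2 F).
    exists a => //=; case: ifP => // _.
    by apply: vgeW al; rewrite lez_nat.
  by move/hl; rewrite tpglM ?oner_neq0// mul1r torus_char1.
suff /(xgetPex 0%N)[] : exists l, [set l | trivialOn chi l /\
    forall k, trivialOn chi k -> (l <= k)%N]%classic l by [].
exists (ex_minn ex); case: ex_minnP => m /asboolP hm min; split=> // k hk.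
by apply: min; apply/asboolP.
Qed.

Lemma torus_char_unit u : u != 0 -> fval u = 0 -> vge (conductor chi)%:Z (u - 1) ->
  chi (tpgl u) = 1.
Proof.
move=> u0 vu cu; apply: conductor_trivialOn; exists u => //=.
by case: ifP.
Qed.

End TorusCharacter.

(** * Transformation rules of [f] under the infinitesimal part, the torus and [Keps] *)

Section Values.
Variables (R : realType) (F : nonarchLocalFieldType).
Hypothesis charF : 2%N \notin [pchar F].
Variables (psi0 : F -> R[i]) (hpsi0 : isUnramifiedAddChar psi0).
Variables (c : F) (chi : PGL2 F -> R[i]) (hchi : isTorusCharacter chi).
Variables (f : PGL2 (dualNum F) -> R[i]) (hV : isV psi0 c chi f).
Hypothesis hK : Keps_invariant f.

Lemma addChar_int t : vge 0 t -> psi0 t = 1.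
Proof.
by move=> t0; rewrite -[t]mulr1; apply: (proj2 (addChar_conductor hpsi0 t)) => //;
  rewrite inE /vge fval1 lexx orbT.
Qed.

(* Dividing by the scalar [1 + eps tr(m')/2] makes the matrix [m'] traceless. *)
Lemma isV_eps (p q s t : F) (M : 'M[F]_2) : M \in unitmx -> vge 0 (c * (p - t)) ->
  f (pgl (mx22 (dualpair 1 p) (dualpair 0 q) (dualpair 0 s) (dualpair 1 t)
          *m map_mx (@dual_inj F) M)) = f (inclG (pgl M)).
Proof.
move=> uM cpt; have two0 : 2 != 0 :> F by move: charF; rewrite inE.
pose h := (p + t) / 2; pose m' := mx22 (p - h) q s (t - h).
have tr0 : \tr m' = 0.
  rewrite trace_mx22 addrACA -opprD -mulr2n -mulr_natr divfK//.
  by rewrite subrr.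
have uh : dualpair 1 h \is a GRing.unit by rewrite dual_unitE unitr1.
have u1 : 1%:M + @dual_eps F *: map_mx (@dual_inj F) m' \in unitmx.
  rewrite map_mx22 scale_mx22 scalar_mx22 add_mx22 unitmx_mx22 dual_unitE !dualE /=.
  by rewrite !(mul0r, addr0, mulr0, subr0, mulr1) unitr1.
have -> : mx22 (dualpair 1 p) (dualpair 0 q) (dualpair 0 s) (dualpair 1 t) =
    dualpair 1 h *: (1%:M + @dual_eps F *: map_mx (@dual_inj F) m').
  rewrite map_mx22 !scale_mx22 scalar_mx22 add_mx22 scale_mx22.
  by congr mx22; apply: dualP; rewrite !dualE /=; ring.
have u2 := dual_inj_unitmx uM.
have u12 : (1%:M + @dual_eps F *: map_mx (@dual_inj F) m') *m
    map_mx (@dual_inj F) M \in unitmx by rewrite unitmx_mul u1.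
rewrite -scalemxAl (pgl_scale u12 uh) -(pglM u1 u2) -(inclG_pgl uM).
rewrite (V_psi hV _ tr0).
rewrite /psi_ /m_ mul_mx22 trace_mx22 addChar_int ?mul1r//.
(* The trace is [c * (p - h) - c * (t - h)], where the shift [h] cancels. *)
by rewrite (_ : _ + _ = c * (p - t)) //; ring.
Qed.

Lemma isV_torus (a : F) (M : 'M[F]_2) : a != 0 ->
  f (inclG (tpgl a * pgl M)%g) = chi (tpgl a) * f (inclG (pgl M)).
Proof. by move=> a0; apply: (V_chi hV); exact: torus_tpgl. Qed.

(** Conjugation: [u_(u b) = t_u u_b t_u^-1], where the right factor lies in [Keps] and the left one
    contributes [chi (tpgl u) = 1]. *)
Lemma isV_upgl_unit (u b : F) : u != 0 -> fval u = 0 -> vge (conductor chi)%:Z (u - 1) ->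
  f (inclG (upgl (u * b))) = f (inclG (upgl b)).
Proof.
move=> u0 vu cu; have vu0 : u^-1 != 0 by rewrite invr_eq0.
have uu := tpgl_unitmx u0; have uv := tpgl_unitmx vu0; have ub := upgl_unitmx b.
have uub : mx22 u (u * b) 0 1 \in unitmx.
  by rewrite unitmx_mx22 mulr0 subr0 mulr1 unitfE.
have e : upgl (u * b) = (pgl (mx22 u (u * b) 0 1) * pgl (mx22 u^-1 0 0 1))%g.
  by rewrite (pglM uub uv) mul_mx22 !(mulr0, mul0r, mulr1, addr0, add0r) mulfV.
have kV : Keps (inclG (pgl (@mx22 F u^-1 0 0 1))).
  have h1 : u^-1 * 1 - 0 * 0 = u^-1 :> F by rewrite mulr0 subr0 mulr1.
  have h2 : u^-1 * 1 - 0 * 0 != 0 :> F by rewrite h1.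
  have h3 : fval (u^-1 * 1 - 0 * 0 : F) = 0 by rewrite h1 fvalV// vu oppr0.
  exact: (inclG_Keps (vgeV vu) (vge0 F 0) (vge0 F 0) (vge1 F) h2 h3).
rewrite e (inclGM uub uv) (hK _ kV).
have -> : pgl (mx22 u (u * b) 0 1) = (tpgl u * upgl b)%g.
  rewrite /tpgl /upgl (pglM uu ub) mul_mx22.
  by rewrite !(mulr0, mul0r, mulr1, addr0, add0r).
rewrite -[RHS]mul1r -[X in X * _](torus_char_unit hchi u0 vu cu).
exact: (isV_torus (mx22 1 b 0 1) u0).
Qed.

Lemma invariant_upgl_int (b o : F) : vge 0 o ->
  f (inclG (upgl (b + o))) = f (inclG (upgl b)).
Proof.
move=> o0; have -> : upgl (b + o) = (upgl b * upgl o)%g.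
  rewrite /upgl (pglM (upgl_unitmx b) (upgl_unitmx o)) mul_mx22.
  by rewrite !(mulr0, mul0r, mulr1, mul1r, addr0, add0r) addrC.
have kU : Keps (inclG (upgl o)).
  apply: (inclG_Keps (vge1 F) o0 (vge0 F 0) (vge1 F)).
    by rewrite mulr0 subr0 mulr1 oner_neq0.
  by rewrite mulr0 subr0 mulr1 fval1.
rewrite (inclGM (upgl_unitmx b) (upgl_unitmx o)).
exact: (hK _ kU).
Qed.

(** * Values of [f] at translates by the coset representatives *)

Variables (varpi : F) (hvarpi : uniformizer varpi) (vc : 0 < fval c).

Lemma isV_rep1 (xt b : F) k : vge 0 xt ->
  f (inclG (upgl b) * pgl (rep1 varpi xt k))%g =
  chi (tpgl varpi) * f (inclG (@upgl F ((b + rlift k.1) / varpi))).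
Proof.
move=> xt0; have p0 := uniformizer_neq0 hvarpi.
set l := rlift k.1; set l' := rlift k.2; pose p := xt / varpi.
have uM : mx22 varpi (b + l) 0 1 \in unitmx.
  by rewrite unitmx_mx22 mulr0 subr0 mulr1 unitfE.
rewrite (inclG_pgl (upgl_unitmx b)) (pglM (dual_inj_unitmx (upgl_unitmx b)) (rep1_unit xt hvarpi k)).
(* Splits off [1 + e m'] on the left; [p] is chosen so that [p * varpi = xt], and the remaining
   matrix over F is [t_varpi u_((b + l) / varpi)]. *)
have -> : map_mx (@dual_inj F) (mx22 1 b 0 1) *m rep1 varpi xt k =
    mx22 (dualpair 1 p) (dualpair 0 (l' - p * (b + l))) (dualpair 0 0) (dualpair 1 0)
    *m map_mx (@dual_inj F) (mx22 varpi (b + l) 0 1).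
  rewrite /rep1 !map_mx22 !mul_mx22 -/l -/l'.
  by congr mx22; apply: dualP; rewrite !dualE /= /p; field.
have cp : vge 0 (c * (p - 0)).
  rewrite subr0 /p mulrA -[varpi]expr1z -(subrr (1 : int)); apply: vge_divz => //.
  by rewrite -[1]addr0; apply: vgeM => //; rewrite /vge -gtz0_ge1 vc orbT.
apply: etrans (isV_eps _ _ uM cp) _.
apply: etrans (isV_torus (mx22 1 ((b + l) / varpi) 0 1) p0); congr (f (inclG _)).
rewrite /tpgl (pglM (tpgl_unitmx p0) (upgl_unitmx _)) mul_mx22.
by rewrite !(mulr0, mul0r, mulr1, mul1r, addr0, add0r) mulrC divfK.
Qed.

Lemma isV_rep2 (xt : F) (r : int) k : vge 0 xt -> r <= fval c ->
  f (inclG (upgl (varpi ^ (- r))) * pgl (rep2 varpi xt k))%g =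
  (chi (tpgl varpi))^-1 * f (inclG (upgl (varpi ^ (- (r - 1))))).
Proof.
move=> xt0 rc; have p0 := uniformizer_neq0 hvarpi.
set b := varpi ^ (- r); set z := rlift k; pose g := xt / varpi.
have uM : mx22 1 (b * varpi) 0 varpi \in unitmx.
  by rewrite unitmx_mx22 mulr0 subr0 mul1r unitfE.
rewrite (inclG_pgl (upgl_unitmx b)) (pglM (dual_inj_unitmx (upgl_unitmx b)) (rep2_unit xt hvarpi k)).
have -> : map_mx (@dual_inj F) (mx22 1 b 0 1) *m rep2 varpi xt k =
    mx22 (dualpair 1 (b * z)) (dualpair 0 (b * g - b * z * b)) (dualpair 0 z)
         (dualpair 1 (g - z * b))
    *m map_mx (@dual_inj F) (mx22 1 (b * varpi) 0 varpi).
  rewrite /rep2 !map_mx22 !mul_mx22 -/z.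
  by congr mx22; apply: dualP; rewrite !dualE /= /g; field.
have c1 : vge 1 c by rewrite /vge -gtz0_ge1 vc orbT.
have cr : vge r c by rewrite /vge rc orbT.
have cp : vge 0 (c * (b * z - (g - z * b))).
  (* The bound [r <= fval c] makes [c * b * z] integral, and [0 < fval c] does so for
     [c * xt / varpi]. *)
  have -> : c * (b * z - (g - z * b)) = (c * b * z + c * b * z) - c * xt / varpi.
    by rewrite /g; ring.
  apply: vgeB.
    suff h : vge 0 (c * b * z) by apply: vgeD.
    rewrite -[0]addr0; apply: vgeM; last exact: vge_rlift.
    by rewrite -(subrr r); apply: vgeM => //; exact: vge_expz.
  rewrite -[varpi]expr1z -(subrr (1 : int)); apply: vge_divz => //.
  by rewrite -[1]addr0; apply: vgeM.
have vp0 : varpi^-1 != 0 by rewrite invr_eq0.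
apply: etrans (isV_eps _ _ uM cp) _; rewrite -(torus_charV hchi p0).
apply: etrans (isV_torus (mx22 1 (varpi ^ (- (r - 1))) 0 1) vp0); congr (f (inclG _)).
rewrite /tpgl (pglM (tpgl_unitmx vp0) (upgl_unitmx _)) mul_mx22.
have uv : varpi^-1 \is a GRing.unit by rewrite unitfE.
(* Scaling by [varpi^-1] turns the matrix into [t_(varpi^-1) u_(b varpi)]. *)
rewrite -(pgl_scale uM uv) scale_mx22.
rewrite !(mulr0, mul0r, mulr1, mul1r, addr0, add0r) mulVf//.
by rewrite opprB addrC expfzDr// expr1z.
Qed.

Variable x : residueField F.
Local Notation q := (residueCard F).
Local Notation X := (chi (tpgl varpi)).
Local Notation U b := (f (inclG (@upgl F b))).

Lemma residueCard_neq0 : q%:R != 0 :> R[i].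
Proof.
rewrite pnatr_eq0 /residueCard cardfs_eq0; apply/eqP => e.
have := in_fset_set (@finite_residueField F) (0 : residueField F).
by rewrite e inE in_setT.
Qed.

Lemma hecke_eltE : hecke_elt varpi x = tpgl (dualpair varpi (rlift x)).
Proof.
rewrite /hecke_elt; congr tpgl; apply: dualP; rewrite !dualE /=.
  by rewrite mul0r addr0.
by rewrite mul0r mul1r !add0r.
Qed.

(** The factor q^-1 cancels in both sums: the values at [rep1] do not depend on [k.2], and those at
    [rep2] do not depend on [k]. *)
Lemma heckeT_upgl (r : int) : r <= fval c ->
  heckeT varpi x f (inclG (upgl (varpi ^ (- r)))) =
  X * (\sum_(k \in setT) U ((varpi ^ (- r) + rlift k) / varpi)) +
  X^-1 * U (varpi ^ (- (r - 1))).
Proof.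
move=> rc; have fin := @finite_residueField F.
have xt0 := vge_rlift x.
have q0 := residueCard_neq0.
rewrite /heckeT hecke_eltE (fsum_leftCosets hvarpi xt0).
(* The element picked by [xget] differs from [g] by a right factor in [Keps]. *)
have getE g : f (inclG (upgl (varpi ^ (- r))) *
    xget 1%g [set (g * k)%g | k in @Keps F]%classic)%g =
    f (inclG (upgl (varpi ^ (- r))) * g)%g.
  have : [set (g * k)%g | k in @Keps F]%classic
      (xget 1%g [set (g * k)%g | k in @Keps F]%classic).
    by apply: xgetPex; exists (g * 1)%g; exists 1%g => //; exact: Keps1.
  by case=> k kK <-; rewrite mulgA; exact: hK kK.
under eq_fsbigr => k _ do rewrite getE isV_rep1//.
under [X in _ + X]eq_fsbigr => k _ do rewrite getE isV_rep2//.
rewrite fsum_const// -/(residueCard F) mulrDr mulKf//; congr (_ + _).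
rewrite -setXTT -(pair_fsbig _ (fun k (_ : residueField F) =>
  X * U ((varpi ^ (- r) + rlift k) / varpi)))//.
under eq_fsbigr => k _ do rewrite fsum_const// -/(residueCard F).
rewrite -mulr_fsumr mulKf//.
by rewrite mulr_fsumr.
Qed.

End Values.

(** * The sum over the residue field, for positive [r] and for [r = 0] *)

Section HeckeSums.
Variables (R : realType) (F : nonarchLocalFieldType).
Variables (chi : PGL2 F -> R[i]) (hchi : isTorusCharacter chi).
Variables (psi0 : F -> R[i]) (c : F).
Variables (f : PGL2 (dualNum F) -> R[i]) (hV : isV psi0 c chi f).
Hypothesis hK : Keps_invariant f.
Variables (varpi : F) (hvarpi : uniformizer varpi).
Local Notation q := (residueCard F).
Local Notation U b := (f (inclG (@upgl F b))).

Lemma fsum_isV_upgl_gt0 (r : int) : 0 < r -> (conductor chi)%:Z <= r ->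
  \sum_(k \in setT) U ((varpi ^ (- r) + rlift k) / varpi) =
  q%:R * U (varpi ^ (- (r + 1))).
Proof.
move=> r0 cr; have p0 := uniformizer_neq0 hvarpi.
rewrite -(fsum_const _ (@finite_residueField F)); apply: eq_fsbigr => k _.
set u := 1 + varpi ^ r * rlift k.
have vr : vge r (varpi ^ r * rlift k).
  by rewrite -[r in vge r]addr0; apply: vgeM; [exact: vge_expz | exact: vge_rlift].
(* Positivity of [r] makes [u] a unit; the bound on the conductor enters at the end, where [chi] is
   trivial on it. *)
have [u0 vu] : u != 0 /\ fval u = 0.
  by apply: fvalD1; apply: vgeW vr; rewrite -gtz0_ge1.
have -> : (varpi ^ (- r) + rlift k) / varpi = u * varpi ^ (- (r + 1)).
  rewrite opprD expfzDr// mulrA -[varpi ^ (-1)]/(varpi^-1); congr (_ / _).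
  rewrite mulrDl mul1r mulrAC -expfzDr// subrr expr0z mul1r.
  by [].
apply: (isV_upgl_unit hchi hV hK _ u0 vu).
by apply: vgeW cr _; rewrite /u addrAC subrr add0r.
Qed.

(* [(1 + rlift k) / varpi] is integral when [k] is the class of -1, and a unit
   times [varpi^-1] otherwise. *)
Lemma fsum_isV_upgl0 : conductor chi = 0%N ->
  \sum_(k \in setT) U ((1 + rlift k) / varpi) =
  (q%:R - 1) * U (varpi ^ (- 1)) + U 1.
Proof.
rewrite -[varpi ^ (- 1)]/(varpi^-1) => c0; have p0 := uniformizer_neq0 hvarpi.
have fin := @finite_residueField F.
have vN1 : vge 0 (-1 : F) by rewrite vgeN vge1.
(* [k0] is the class of -1, so that [1 + rlift k0 = - varpi * e]. *)
have [k0 [e [e0 k0E]]] := rlift_surj hvarpi vN1.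
have U1 : U 1 = U 0.
  by have := invariant_upgl_int hK 0 (vge1 F); rewrite add0r.
have k0U : U ((1 + rlift k0) / varpi) = U 1.
  have -> : (1 + rlift k0) / varpi = 0 + - e.
    have -> : 1 + rlift k0 = - e * varpi.
      have -> : rlift k0 = -1 - varpi * e by rewrite k0E addrK.
      by ring.
    by rewrite add0r mulfK.
  have ve : vge 0 (- e) by rewrite vgeN.
  have e' := invariant_upgl_int hK 0 ve.
  by transitivity (U 0); [exact e' | exact (esym U1)].
have kU k : k <> k0 -> U ((1 + rlift k) / varpi) = U varpi^-1.
  move=> kk0.
  have v0 : vge 0 (1 + rlift k) by apply: vgeD; [exact: vge1 | exact: vge_rlift].
  (* Otherwise [rlift k - rlift k0] would be an integral multiple of [varpi], and [k] would equal
     [k0]. *)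
  have nv : ~~ vge 1 (1 + rlift k).
    apply/negP => /(vge_divz hvarpi 1); rewrite expr1z subrr => h.
    apply: kk0; apply: (rlift_inj (varpi := varpi) hvarpi (e := (1 + rlift k) / varpi + e)).
      exact: vgeD.
    rewrite mulrDr mulrCA (divff p0) mulr1.
    have -> : rlift k0 = -1 - varpi * e by rewrite k0E addrK.
    by ring.
  have u0 : 1 + rlift k != 0 by apply: contraNneq nv => ->; exact: vge0.
  have vu : fval (1 + rlift k) = 0.
    by apply/eqP; apply: contraNT nv; exact: vge_gt0.
  apply: (isV_upgl_unit hchi hV hK _ u0 vu).
  by rewrite c0 addrAC subrr add0r vge_rlift.
have S1 : \sum_(k \in setT `\ k0) U ((1 + rlift k) / varpi) =
    (q%:R - 1) * U varpi^-1.
  have -> : \sum_(k \in setT `\ k0) U ((1 + rlift k) / varpi) =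
            \sum_(k \in setT `\ k0) U varpi^-1.
    by apply: eq_fsbigr => k; rewrite inE => -[_ kk0]; exact (kU k kk0).
  (* Adding the missing term at [k0] completes the constant sum to one over all q classes. *)
  apply: (addrI (U varpi^-1)).
  rewrite -(@fsbigD1 _ _ _ _ k0 _ (fun=> U varpi^-1) fin I) (fsum_const _ fin).
  by rewrite mulrBl mul1r addrC subrK.
rewrite (@fsbigD1 _ _ _ _ k0 _ _ fin I) [LHS]addrC S1.
exact (f_equal (fun t => (q%:R - 1) * U varpi^-1 + t) k0U).
Qed.

End HeckeSums.

Theorem claim4p8 (R : realType) (F : nonarchLocalFieldType)
    (charF : 2%N \notin [pchar F])
    (varpi : F) (hvarpi : uniformizer varpi)
    (psi0 : F -> R[i]) (hpsi0 : isUnramifiedAddChar psi0)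
    (c : F) (c_neq0 : c != 0) (hc : 0 < fval c)
    (chi : PGL2 F -> R[i]) (hchi : isTorusCharacter chi)
    (x : residueField F) (r : int)
    (hr1 : (conductor chi)%:Z <= r) (hr2 : r <= fval c)
    (f : PGL2 (dualNum F) -> R[i]) (hV : isV psi0 c chi f)
    (hK : Keps_invariant f) :
  (0 < r ->
     heckeT varpi x f (inclG (upgl (varpi ^ (- r)))) =
       (residueCard F)%:R * chi (tpgl varpi) * f (inclG (upgl (varpi ^ (- (r + 1)))))
       + (chi (tpgl varpi))^-1 * f (inclG (upgl (varpi ^ (- (r - 1)))))) /\
  (conductor chi = 0%N ->
     heckeT varpi x f (inclG (upgl (varpi ^ (- 0)))) =
       ((residueCard F)%:R - 1) * chi (tpgl varpi) * f (inclG (upgl (varpi ^ (- 1))))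
       + (chi (tpgl varpi) + (chi (tpgl varpi))^-1) * f (inclG (upgl (varpi ^ (- 0))))).
Proof.
split=> [r0|c0].
  rewrite (heckeT_upgl charF hpsi0 hchi hV hK hvarpi hc x hr2).
  by rewrite (fsum_isV_upgl_gt0 hchi hV hK hvarpi r0 hr1) mulrCA mulrA.
rewrite (heckeT_upgl charF hpsi0 hchi hV hK hvarpi hc x (ltW hc)).
rewrite oppr0 expr0z (fsum_isV_upgl0 hchi hV hK hvarpi c0).
(* The exponent [-(0 - 1)] is 1; [u_varpi] and [u_1] both have integral entries, so [f] takes its
   value at the identity on both. *)
have e0 : f (inclG (upgl (varpi ^ (- (0 - 1))))) = f (inclG (upgl 1)).
  have v0 : vge 0 varpi by rewrite -[varpi]expr1z; apply: vgeW (vge_expz hvarpi 1).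
  have U1 := invariant_upgl_int hK 0 (vge1 F); rewrite add0r in U1.
  have Uv := invariant_upgl_int hK 0 v0; rewrite add0r in Uv.
  rewrite add0r opprK expr1z.
  by transitivity (f (inclG (@upgl F 0))); [exact Uv | exact (esym U1)].
have alg (X Y q a b : R[i]) :
  X * ((q - 1) * a + b) + Y * b = (q - 1) * X * a + (X + Y) * b by ring.
exact (etrans (f_equal (fun t => _ + _ * t) e0) (alg _ _ _ _ _)).
Qed.
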